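(* Let $X$ be a random variable taking values in $I_0=\{0,1,2,\ldots\}$ which is infinitely divisible with integer-valued components. Then necessarily $P\{X=0\}>0$.
   Context: A random variable $X$ on $I_0=\{0,1,2,\ldots\}$ is infinitely divisible with integer-valued components if for every integer $n\ge 1$ there exist independent and identically distributed random variables $X_1,\ldots,X_n$ (depending on $n$), taking values in $I_0$, such that $X\overset{d}{=}X_1+\cdots+X_n$ (equality in distribution). The $X_i$ are called the components of $X$. *)

(* Defs.v *)
From HB Require Import structures.
From mathcomp Require Import all_boot all_order all_algebra.
From mathcomp Require Import all_classical all_reals all_analysis.
From mathcomp Require Import measurable_realfun.

Set Implicit Arguments.
Unset Strict Implicit.
Unset Printing Implicit Defensive.

Local Open Scope classical_set_scope.
Local Open Scope ereal_scope.

(* The two variables may live on different probability spaces. *)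
Definition eq_in_distribution (d1 d2 d' : measure_display)
    (T1 : measurableType d1) (T2 : measurableType d2) (S : measurableType d')
    (R : realType) (P1 : probability T1 R) (P2 : probability T2 R)
    (X : {RV P1 >-> S}) (Y : {RV P2 >-> S}) : Prop :=
  forall A : set S, measurable A -> distribution P1 X A = distribution P2 Y A.

Definition mutually_independent (d d' : measure_display)
    (T : measurableType d) (S : measurableType d') (R : realType)
    (P : probability T R) (I : finType) (X : I -> {RV P >-> S}) : Prop :=
  forall (J : {set I}) (A : I -> set S),
    (forall i, i \in J -> measurable (A i)) ->
    P (\bigcap_(i in [set` J]) (X i @^-1` A i)) =
    \prod_(i in J) P (X i @^-1` A i).

Definition identically_distributed (d d' : measure_display)
    (T : measurableType d) (S : measurableType d') (R : realType)
    (P : probability T R) (I : Type) (X : I -> {RV P >-> S}) : Prop :=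
  forall i j : I, eq_in_distribution (X i) (X j).

Section sum_of_nat_valued_random_variables.
Context (d : measure_display) (T : measurableType d) (R : realType)
  (P : probability T R) (n : nat) (X : 'I_n -> {RV P >-> nat}).

Definition sum_fun : T -> nat := fun w => (\sum_(i < n) X i w)%N.

Let measurable_sum_fun : measurable_fun [set: T] sum_fun.
Proof.
rewrite /sum_fun; elim: (index_enum _) => [|i s IHs].
  by under eq_fun do rewrite big_nil; exact: measurable_cst.
under eq_fun do rewrite big_cons.
exact: measurable_fun_addn.
Qed.

HB.instance Definition _ :=
  @isMeasurableFun.Build _ _ T nat sum_fun measurable_sum_fun.

Definition RV_sum : {RV P >-> nat} := sum_fun.

End sum_of_nat_valued_random_variables.

(* For each n the components may be defined on a probability space of their
   own, unrelated to the one carrying X. *)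
Definition infinitely_divisible_nat (d : measure_display)
    (T : measurableType d) (R : realType) (P : probability T R)
    (X : {RV P >-> nat}) : Prop :=
  forall n : nat, (1 <= n)%N ->
    exists (d' : measure_display) (T' : measurableType d')
      (Q : probability T' R) (Y : 'I_n -> {RV Q >-> nat}),
      [/\ mutually_independent Y,
          identically_distributed Y
        & eq_in_distribution X (RV_sum Y)].

(* Main.v *)
(* Suppose P(X = 0) = 0 and split X into k + 1 components Y_i. Some Y_i vanishes
   with probability zero, because P(X = 0) is the product of the Q(Y_i = 0);
   being identically distributed, all of them do. A sum of k + 1 naturals equal
   to k has a zero term, so P(X = k) = 0 for every k, contradicting P(T) = 1. *)
Require Import Defs.
From mathcomp Require Import all_boot all_order all_algebra.
From mathcomp Require Import all_classical all_reals all_analysis.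

Local Open Scope classical_set_scope.
Local Open Scope ereal_scope.

(** Otherwise each of the [n] terms is at least 1, and comparison with a sum of [n] ones bounds the
    total below by [n]. *)
Lemma sum_lt_exists_eq0 {n : nat} {F : 'I_n -> nat} :
  (\sum_(i < n) F i < n)%N -> exists i, F i = 0%N.
Proof.
move=> sumF; apply/not_existsP => F_neq0; move: sumF; apply/negP.
rewrite -leqNgt -[leqLHS]card_ord -sum1_card; apply: leq_sum => i _.
by rewrite lt0n; apply/eqP; exact: F_neq0.
Qed.

Lemma prode_eq0 {R : numDomainType} {I : finType} {F : I -> \bar R} :
  \prod_(i in I) F i = 0 -> exists i, F i = 0.
Proof.
move=> prod0; apply/not_existsP => F_neq0; move/eqP: prod0; apply/negP.
elim/big_ind: _ => [||i _]; last exact/eqP/F_neq0; last exact: mule_neq0.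
by rewrite onee_neq0.
Qed.

Lemma measurable_preimage_nat {d : measure_display} {T : measurableType d}
    {R : realType} {P : probability T R} (X : {RV P >-> nat}) (A : set nat) :
  measurable (X @^-1` A).
Proof. by rewrite -[X in measurable X]setTI; exact: measurable_funP. Qed.

(** Naturals sum to zero only if all of them vanish, so the event is an intersection to which
    independence applies. *)
Lemma prob_RV_sum_eq0 {d : measure_display} {T : measurableType d}
    {R : realType} {P : probability T R} {n : nat}
    {Y : 'I_n -> {RV P >-> nat}} :
  mutually_independent Y ->
  P (RV_sum Y @^-1` [set 0%N]) = \prod_(i in 'I_n) P (Y i @^-1` [set 0%N]).
Proof.
(* Independence is used for the full index set; every set of naturals is measurable, hence the
   trivial proof [Logic.I]. *)
move=> /(_ [set: 'I_n]%SET (fun=> [set 0%N]) (fun _ _ => Logic.I)).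
under eq_bigl do rewrite finset.in_setT.
move=> <-; congr (P _); apply/seteqP; split=> w /=.
  by move=> /eqP; rewrite sum_nat_eq0 => /forallP Y0 i _; apply/eqP/Y0.
by move=> Y0; apply: big1 => i _; apply: Y0; rewrite /= finset.in_setT.
Qed.

Lemma prob_RV_sum_small {d : measure_display} {T : measurableType d}
    {R : realType} {P : probability T R} {k : nat}
    {Y : 'I_k.+1 -> {RV P >-> nat}} :
  (forall i, P (Y i @^-1` [set 0%N]) = 0) -> P (RV_sum Y @^-1` [set k]) = 0.
Proof.
move=> Y0; apply: measure_negligible; first exact: measurable_preimage_nat.
(* The finite union is indexed by all naturals to use countable subadditivity; for [j > k],
   [inord j] defaults to index 0, which only repeats a null event. *)
apply: (@negligibleS _ _ _ _ (\bigcup_j (Y (inord j) @^-1` [set 0%N]))).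
  move=> w /= sumYw; have [|i Yi0] := @sum_lt_exists_eq0 k.+1 (Y ^~ w).
    by rewrite ltnS -[leqRHS]sumYw.
  by exists (i : nat) => //=; rewrite inord_val.
apply: negligible_bigcup => j.
by apply/negligibleP; [exact: measurable_preimage_nat|exact: Y0].
Qed.

Theorem theorem1 (R : realType) (d : measure_display) (T : measurableType d)
    (P : probability T R) (X : {RV P >-> nat}) :
  infinitely_divisible_nat X -> 0 < P [set w | X w = 0%N].
Proof.
move=> Xid; rewrite lt0e measure_ge0 andbT; apply/eqP => X0.
have Xk k : P (X @^-1` [set k]) = 0.
  have [//|d' [T' [Q [Y [indY idY XY]]]]] := Xid k.+1.
  have {}XY j : P (X @^-1` [set j]) = Q (RV_sum Y @^-1` [set j]) by exact: XY.
  rewrite XY; apply: prob_RV_sum_small => i.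
  have /prode_eq0[j Yj0] : \prod_(j in 'I_k.+1) Q (Y j @^-1` [set 0%N]) = 0.
    by rewrite -(prob_RV_sum_eq0 indY) -XY.
  by rewrite -[RHS]Yj0; exact: (idY i j).
have : P [set: T] = 0.
  apply: measure_negligible => //.
  (* The fibres of [X] are countably many null sets covering the whole space. *)
  rewrite (_ : [set: T] = \bigcup_k (X @^-1` [set k])); last first.
    by apply/seteqP; split=> // w _; exists (X w).
  apply: negligible_bigcup => k.
  by apply/negligibleP; [exact: measurable_preimage_nat|exact: Xk].
by move=> /eqP; rewrite probability_setT onee_eq0.
Qed.
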